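(* Consider the two-sided interconnection $$\dot\omega=S\omega,\qquad \dot x=Ax+BL\omega,\qquad \dot\varpi=Q\varpi+RCx,\qquad d=\varpi+\Upsilon x,$$ with $\varpi(0)=0$ and $\omega(0)=\omega_0$, where $\Pi,\Upsilon$ are the unique solutions of the Sylvester equations $A\Pi+BL=\Pi S$ and $Q\Upsilon=\Upsilon A+RC$. Suppose that: (1) $(S,L)$ is observable and $(Q,R)$ is controllable; (2) $\sigma(A)\subset\mathbb{C}_{<0}$, $S$ has simple eigenvalues with $\sigma(S)\subset\mathbb{C}_0$, and the pair $(S,\omega_0)$ is excitable; (3) $Q$ has simple eigenvalues with $\sigma(Q)\subset\mathbb{C}_0$, and $x(0)=0$; (4) $\sigma(S)\cap\sigma(A)=\emptyset$, $\sigma(Q)\cap\sigma(A)=\emptyset$, $\sigma(S)\cap\sigma(Q)=\emptyset$; (5) the matrix $\Upsilon\Pi\in\mathbb{R}^{\nu\times\nu}$ is invertible. Let the time-snapshot matrices $M_k\in\mathbb{R}^{p\nu\times\nu^2}$ and $N_k\in\mathbb{R}^{p\nu}$, with $p\ge\nu$, be defined as $$M_k=\begin{bmatrix}(d(t_{k-p+1})^\top-\varpi(t_{k-p+1})^\top)\otimes I_\nu\\ \vdots\\ (d(t_{k-1})^\top-\varpi(t_{k-1})^\top)\otimes I_\nu\\ (d(t_k)^\top-\varpi(t_k)^\top)\otimes I_\nu\end{bmatrix},\qquad N_k=\begin{bmatrix}\omega(t_{k-p+1})^\top&\cdots&\omega(t_{k-1})^\top&\omega(t_k)^\top\end{bmatrix}^\top.$$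 Assume that the matrix $M_k$ has full column rank. Then $\widetilde\Sigma_k\in\mathbb{R}^{\nu\times\nu}$ defined by $$\operatorname{vec}(\widetilde\Sigma_k):=(M_k^\top M_k)^{-1}M_k^\top N_k$$ is an online estimate of $(\Upsilon\Pi)^{-1}$, namely there exists a sequence $\{t_k\}$ such that $$\lim_{k\to\infty}\widetilde\Sigma_k=(\Upsilon\Pi)^{-1}.$$
   Context: Setting: $A\in\mathbb{R}^{n\times n}$, $B\in\mathbb{R}^{n\times1}$, $C\in\mathbb{R}^{1\times n}$ define a minimal (controllable and observable) single-input single-output linear system $\dot x=Ax+Bu$, $y=Cx$. The signal generators have $S,Q\in\mathbb{R}^{\nu\times\nu}$, $L\in\mathbb{R}^{1\times\nu}$, $R\in\mathbb{R}^{\nu\times1}$, with states $\omega(t),\varpi(t)\in\mathbb{R}^\nu$ and $d(t)\in\mathbb{R}^\nu$. The matrices $\Pi\in\mathbb{R}^{n\times\nu}$ and $\Upsilon\in\mathbb{R}^{\nu\times n}$ are the unique solutions of $A\Pi+BL=\Pi S$ and $Q\Upsilon=\Upsilon A+RC$ (unique because $\sigma(S)\cap\sigma(A)=\sigma(Q)\cap\sigma(A)=\emptyset$). Notation: $\sigma(\cdot)$ is the spectrum; $\mathbb{C}_0$ (resp. $\mathbb{C}_{<0}$) is the set of complex numbers with zero (resp. negative) real part; $\otimes$ is the Kronecker product; $I_\nu$ is the $\nu\times\nu$ identity; $\operatorname{vec}$ stacks the columns of a matrix. Excitable pair: $(S,\omega_0)$ is excitable if $\operatorname{rank}[\omega_0\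 \ S\omega_0\ \cdots\ S^{\nu-1}\omega_0]=\nu$. The $t_k$ are sampling times, and $M_k$, $N_k$ and $\widetilde\Sigma_k$ are formed from the samples at $t_{k-p+1},\dots,t_k$; the full column rank of $M_k$ is a hypothesis, not part of the conclusion. *)

(* Defs.v *)
From HB Require Import structures.
From mathcomp Require Import all_boot all_order all_algebra.
From mathcomp Require Import all_classical all_reals all_analysis.
From mathcomp Require Import complex mxtens.

Set Implicit Arguments.
Unset Strict Implicit.
Unset Printing Implicit Defensive.

Import Order.TTheory GRing.Theory Num.Theory.
Import numFieldNormedType.Exports.

Local Open Scope classical_set_scope.
Local Open Scope ring_scope.
Local Open Scope complex_scope.

Definition complexify (R : realType) (n : nat) (A : 'M[R]_n) : 'M[R[i]]_n :=
  map_mx (real_complex R) A.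

Definition spectrum (R : realType) (n : nat) (A : 'M[R]_n) : set R[i] :=
  [set z | eigenvalue (complexify A) z].

(* Simple means of algebraic multiplicity one. *)
Definition simple_eigenvalues (R : realType) (n : nat) (A : 'M[R]_n) : Prop :=
  forall z, spectrum A z -> mup z (char_poly (complexify A)) = 1%N.

Definition imaginary_axis (R : realType) : set R[i] := [set z | complex.Re z = 0].

Definition open_left_half_plane (R : realType) : set R[i] :=
  [set z | complex.Re z < 0].

Arguments imaginary_axis R : clear implicits.
Arguments open_left_half_plane R : clear implicits.

(* [ b  A b  ...  A^(n-1) b ] *)
Definition krylov (R : realType) (n : nat) (A : 'M[R]_n) (b : 'cV[R]_n) : 'M[R]_n :=
  \matrix_(i < n, j < n) (A ^+ j *m b) i ord0.

Definition controllable (R : realType) (n : nat) (A : 'M[R]_n) (B : 'cV[R]_n) : Prop :=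
  \rank (krylov A B) = n.

(* The rows of the observability matrix are C, C A, ..., C A^(n-1). *)
Definition observable (R : realType) (n : nat) (A : 'M[R]_n) (C : 'rV[R]_n) : Prop :=
  \rank (\matrix_(i < n, j < n) (C *m A ^+ i) ord0 j) = n.

Definition excitable (R : realType) (n : nat) (S : 'M[R]_n) (w0 : 'cV[R]_n) : Prop :=
  \rank (krylov S w0) = n.

(* Time runs over [0, +oo[; the values of x and f at negative times are
   irrelevant. *)
Definition solves_ode (R : realType) (n : nat) (x f : R -> 'cV[R]_n) (x0 : 'cV[R]_n) :
    Prop :=
  [/\ x 0 = x0,
      {within `[0, +oo[, continuous x} &
      forall t : R, 0 < t -> is_derive t (1 : R) x (f t)].

(* Column stacking: mxtens_unindex sends the position k = j * m + i of
   'I_(n * m) to the pair (j, i), as in the Kronecker product tensmx, whereas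
   the library's mxvec stacks rows. *)
Definition vec (R : realType) (m n : nat) (X : 'M[R]_(m, n)) : 'cV[R]_(n * m) :=
  \col_k X (mxtens_unindex k).2 (mxtens_unindex k).1.

Definition unvec (R : realType) (m n : nat) (v : 'cV[R]_(n * m)) : 'M[R]_(m, n) :=
  \matrix_(i < m, j < n) v (mxtens_index (j, i)) ord0.

Lemma vecK (R : realType) (m n : nat) : cancel (@vec R m n) (@unvec R m n).
Proof. by move=> X; apply/matrixP => i j; rewrite !mxE mxtens_indexK. Qed.

Lemma unvecK (R : realType) (m n : nat) : cancel (@unvec R m n) (@vec R m n).
Proof.
move=> v; apply/matrixP => k j; rewrite !mxE (ord1 j) -surjective_pairing.
by rewrite mxtens_unindexK.
Qed.

(* Sample i < p of the window t_(k-p+1), ..., t_k; only used for p <= k + 1. *)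
Definition window (R : realType) (p : nat) (t : nat -> R) (k : nat) (i : 'I_p) : R :=
  t (k.+1 - p + i)%N.

(* Block i < p is y(t_(k-p+1+i))^T *t I. *)
Definition snapshot_M (R : realType) (nu p : nat) (y : R -> 'cV[R]_nu) (t : nat -> R)
    (k : nat) : 'M[R]_(p * nu, nu * nu) :=
  \matrix_(r, c) ((y (window t k (mxtens_unindex r).1))^T *t (1%:M : 'M[R]_nu))
                   (mxtens_index (ord0, (mxtens_unindex r).2)) c.

Definition snapshot_N (R : realType) (nu p : nat) (w : R -> 'cV[R]_nu) (t : nat -> R)
    (k : nat) : 'cV[R]_(p * nu) :=
  \col_r w (window t k (mxtens_unindex r).1) (mxtens_unindex r).2 ord0.

Definition full_column_rank (R : realType) (m n : nat) (M : 'M[R]_(m, n)) : Prop :=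
  \rank M = n.

(* Sampling sequences for which the least-squares estimate is defined at every
   k with a complete window, i.e. M^T M is invertible there. *)
Definition admissible_sampling (R : realType) (nu p : nat) (y : R -> 'cV[R]_nu)
    (t : nat -> R) : Prop :=
  [/\ 0 <= t 0%N, (forall k, t k < t k.+1), t @ \oo --> +oo &
      forall k, (p <= k.+1)%N -> full_column_rank (snapshot_M p y t k)].

(* The matrix determined by vec(estimate) = (M^T M)^-1 M^T N. *)
Definition estimate (R : realType) (nu p : nat) (y w : R -> 'cV[R]_nu) (t : nat -> R)
    (k : nat) : 'M[R]_nu :=
  let M := snapshot_M p y t k in
  let N := snapshot_N p w t k in
  unvec (invmx (M^T *m M) *m M^T *m N).

(* Main.v *)
Require Import Defs.
From HB Require Import structures.
From mathcomp Require Import all_boot all_order all_algebra.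
From mathcomp Require Import all_classical all_reals all_analysis.
From mathcomp Require Import complex mxtens.
From mathcomp Require Import ring lra.
Import Order.TTheory GRing.Theory Num.Theory.
Import numFieldNormedType.Exports.
Local Open Scope classical_set_scope.
Local Open Scope ring_scope.

Set Implicit Arguments.
Unset Strict Implicit.

(** By the Sylvester equation, e = x - Pi omega solves e' = A e, hence e tends
    to 0 and the regressor is y = d - varpi = Ups Pi omega + Ups e.  Sampling at
    constant step h, t_k = T + k h, suffices: in left eigenvector coordinates,
    omega is given by c_j e^(i theta_j t), with c_j nonzero by excitability and
    theta_j pairwise distinct, so nu consecutive samples form, up to factors of
    constant modulus, the Vandermonde matrix of the e^(i theta_j h), which is
    invertible for small h.  Hence nu consecutive samples of omega, and for
    large T also of y, control a row vector uniformly in the starting time.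
    This gives the full column rank.  The values of the error matrix
    D_k = estimate_k - (Ups Pi)^-1 at the samples of y form an orthogonal
    projection of the residuals -(Ups Pi)^-1 Ups e, which tend to 0, so D_k
    tends to 0 as well. *)

(** * Calculus of real row pairings *)

Section RowPairing.
Context {R : realType} {n : nat}.
Implicit Types (u : 'rV[R]_n) (x : R -> 'cV[R]_n).

Lemma row_pairing_sumE u x :
  (fun s => (u *m x s) 0 0) = \sum_j (u 0 j \*: (fun s => x s j 0)).
Proof. by apply/funext => s; rewrite mxE fct_sumE. Qed.

Lemma is_derive_row_pairing u x dx (t : R) :
  is_derive t (1 : R) x dx ->
  is_derive t (1 : R) (fun s => (u *m x s) 0 0) ((u *m dx) 0 0).
Proof.
move=> hx; rewrite row_pairing_sumE mxE; apply: is_derive_sum => j.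
apply: is_deriveZ.
have dx1 : derivable x t 1 by [].
split; first by have /derivable_mxP := dx1; exact.
have <- : 'D_1 x t = dx by exact: derive_val.
by rewrite derive_mx // mxE.
Qed.

Lemma within_continuous_row_pairing u x (D : set R) :
  {within D, continuous x} -> {within D, continuous (fun s => (u *m x s) 0 0)}.
Proof.
move=> hx; rewrite row_pairing_sumE => s.
elim/big_ind : _ => [|f g hf hg|j _].
- exact: cvg_cst.
- exact: continuousD.
- apply: continuousZl_tmp.
  have hj : continuous (fun M : 'cV[R]_n => M j 0) by exact: coord_continuous.
  exact: (cvg_comp x (fun M : 'cV[R]_n => M j 0) (hx s) (hj (x s))).
Qed.
End RowPairing.

(** * Derivatives under a constant matrix factor *)

Section MatrixDerivative.
Context {R : realType}.

Lemma is_derive_mulmx m n (P : 'M[R]_(m, n)) (x : R -> 'cV[R]_n) dx (t : R) :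
  is_derive t (1 : R) x dx ->
  is_derive t (1 : R) (fun s => P *m x s) (P *m dx).
Proof.
move=> hx.
have hij i (j : 'I_1) : is_derive t (1 : R) (fun s => (P *m x s) i j) ((P *m dx) i j).
  rewrite ord1 -[X in is_derive _ _ _ X](_ : (row i P *m dx) 0 0 = _); last first.
    by rewrite -row_mul mxE.
  have := is_derive_row_pairing (row i P) hx.
  by under eq_fun do rewrite -row_mul mxE.
have dPx : derivable (fun s => P *m x s) t 1.
  by apply/derivable_mxP => i j; case: (hij i j).
split => //; rewrite derive_mx //; apply/matrixP => i j; rewrite mxE.
exact: derive_val.
Qed.
End MatrixDerivative.

(** * Scalar differential equations and inequalities *)

Section ScalarODE.
Context {R : realType}.
Implicit Types (f u a b : R -> R).

Lemma within_ray_itv {T : topologicalType} (f : R -> T) (s t : R) : 0 <= s ->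
  {within `[0, +oo[, continuous f} -> {within `[s, t], continuous f}.
Proof.
move=> s0; apply: continuous_subspaceW => r /=; rewrite !in_itv /= andbT.
by move=> /andP[+ _]; exact: le_trans.
Qed.

Lemma derive0_constant f :
  {within `[0, +oo[, continuous f} ->
  (forall t : R, 0 < t -> is_derive t (1 : R) f 0) ->
  forall t, 0 <= t -> f t = f 0.
Proof.
move=> cf df t t0.
have [|s _] := @MVT_segment R f (fun=> 0) 0 t t0 _ (within_ray_itv (lexx 0) cf).
  by move=> s; rewrite in_itv /= => /andP[s0 _]; exact: df.
by rewrite mul0r => /eqP; rewrite subr_eq0 => /eqP.
Qed.

(** Once [eta <= m * (e / 2)], the function [expR (m * t) * (u t - e / 2)] has nonpositive
    derivative, so [u - e / 2] lies below a decaying exponential. *)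
Lemma gronwall_vanish u du (eta : R -> R) (m : R) : 0 < m ->
  (forall t, 0 <= u t) ->
  (forall t : R, 0 < t -> is_derive t (1 : R) u (du t)) ->
  (forall t : R, 0 < t -> du t <= - m * u t + eta t) ->
  eta t @[t --> +oo] --> (0 : R) -> u t @[t --> +oo] --> (0 : R).
Proof.
move=> m0 u0 hu hdu /cvgrPdist_le heta; apply/cvgrPdist_le => e e0.
have d0 : 0 < m * (e / 2) by rewrite mulr_gt0 ?divr_gt0.
have [T0 [_ hT0]] := heta _ d0.
pose T := Num.max 1 (T0 + 1).
have T_gt0 : 0 < T by rewrite lt_max ltr01.
have hT t : T <= t -> eta t <= m * (e / 2).
  move=> Tt; apply: le_trans (ler_norm _) _; rewrite -normrN -sub0r.
  apply: hT0; apply: lt_le_trans Tt.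
  by rewrite lt_max ltrDl ltr01 orbT.
pose F (s : R) := expR (m * s) * (u s - e / 2).
have dF (s : R) : 0 < s -> is_derive s (1 : R) F
    (expR (m * s) * (m * (u s - e / 2) + du s)).
  move=> s0; have hs := hu _ s0.
  apply: is_derive_eq.
  by rewrite /GRing.scale/=; ring.
pose K := expR (m * T) * u T.
have K0 : 0 <= K by rewrite mulr_ge0 ?expR_ge0.
have key t : T <= t -> expR (m * t) * (u t - e / 2) <= K.
  move=> Tt.
  have cF : {within `[T, t], continuous F}.
    apply: derivable_within_continuous => s; rewrite in_itv /= => /andP[Ts _].
    by have := dF s (lt_le_trans T_gt0 Ts) => -[].
  have [|s] := @MVT_segment R F
      (fun s => expR (m * s) * (m * (u s - e / 2) + du s)) T t Tt _ cF.
    by move=> s; rewrite in_itv /= => /andP[Ts _]; apply: dF; exact: lt_trans Ts.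
  rewrite in_itv /= => /andP[Ts _] hF.
  have : F t <= F T.
    rewrite -subr_le0 hF mulr_le0_ge0 ?subr_ge0 //.
    rewrite mulr_ge0_le0 ?expR_ge0 //.
    have := hdu s (lt_le_trans T_gt0 Ts); have := hT s Ts; lra.
  move=> /le_trans; apply; rewrite /F /K ler_wpM2l ?expR_ge0 //.
  by rewrite lerBlDr lerDl ltW ?divr_gt0.
(* Beyond this time [expR (m * t) >= 1 + m * t >= K / (e / 2)], which makes the remaining
   exponential term at most [e / 2]. *)
exists (Num.max T (K / (e / 2) / m)); split; first exact: num_real.
move=> t; rewrite gt_max => /andP[Tt Kt].
rewrite sub0r normrN ger0_norm //.
have kt := key t (ltW Tt).
have e20 : 0 < e / 2 by rewrite divr_gt0.
have : K <= expR (m * t) * (e / 2).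
  rewrite -ler_pdivrMr //; apply: le_trans (_ : m * t <= _).
    by rewrite [leRHS]mulrC -ler_pdivrMr // ltW.
  by apply: le_trans (expR_ge1Dx _); rewrite lerDr.
move=> /(le_trans kt); rewrite ler_pM2l ?expR_gt0 //; lra.
Qed.

(** Real form of [f' = z f + g] with [f = a + i b] and [z = mu + i theta]. In the derivative of the
    energy [a^2 + b^2] the rotation terms cancel; half of the damping absorbs the forcing, and the
    other half gives the decay. *)
Lemma damped_oscillator_vanish a b (g1 g2 : R -> R) (mu theta : R) : mu < 0 ->
  (forall t : R, 0 < t -> is_derive t (1 : R) a (mu * a t - theta * b t + g1 t)) ->
  (forall t : R, 0 < t -> is_derive t (1 : R) b (theta * a t + mu * b t + g2 t)) ->
  g1 t @[t --> +oo] --> (0 : R) -> g2 t @[t --> +oo] --> (0 : R) ->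
  a t @[t --> +oo] --> (0 : R) /\ b t @[t --> +oo] --> (0 : R).
Proof.
move=> mu0 ha hb hg1 hg2.
have hu : (a t ^+ 2 + b t ^+ 2) @[t --> +oo] --> (0 : R).
  apply: (@gronwall_vanish _ (fun t => 2 * (a t * (mu * a t - theta * b t + g1 t)
      + b t * (theta * a t + mu * b t + g2 t)))
      (fun t => (g1 t * g1 t + g2 t * g2 t) * (- mu)^-1) (- mu)).
  - by rewrite oppr_gt0.
  - by move=> t; rewrite addr_ge0 ?sqr_ge0.
  - move=> t t0; have ha' := ha t t0; have hb' := hb t t0.
    have H := is_deriveD (is_deriveX 2 ha') (is_deriveX 2 hb').
    refine (eq_ind _ (is_derive t (1 : R) _) H _ _).
    by rewrite /GRing.scale /=; ring.
  - move=> t t0.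
    (* Weighted Young inequality, from expanding the square of [mu * z + g]. *)
    have N (g z : R) : 2 * z * g <= - mu * z ^+ 2 + g * g * (- mu)^-1.
      have : 0 <= (- mu)^-1 * (mu * z + g) ^+ 2.
        by rewrite mulr_ge0 ?sqr_ge0 // invr_ge0 oppr_ge0 ltW.
      have -> : (- mu)^-1 * (mu * z + g) ^+ 2 =
          - mu * z ^+ 2 + g * g * (- mu)^-1 - 2 * z * g.
        by field; rewrite lt_eqF.
      by rewrite subr_ge0.
    rewrite [X in _ <= _ + X]mulrDl; move: (N (g1 t) (a t)) (N (g2 t) (b t)).
    by move: (_ / _) (_ / _) => q1 q2; lra.
  - rewrite -(mul0r (- mu)^-1) -[X in X * _](addr0 0).
    rewrite -{1}[X in X + _](mulr0 0) -[X in _ + X](mulr0 0).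
    by apply: cvgM; [apply: cvgD; exact: cvgM|exact: cvg_cst].
have H (f : R -> R) : (forall t, f t ^+ 2 <= a t ^+ 2 + b t ^+ 2) ->
    f t @[t --> +oo] --> (0 : R).
  move=> fab; apply/cvgrPdist_le => e e0.
  have /cvgrPdist_le/(_ (e ^+ 2)) := hu; rewrite exprn_gt0 // => /(_ isT).
  apply: filterS => t; rewrite !sub0r !normrN ger0_norm ?addr_ge0 ?sqr_ge0 //.
  move=> /(le_trans (fab t)); rewrite -real_normK ?num_real //.
  by rewrite ler_pXn2r // nnegrE // ltW.
by split; apply: H => t; rewrite ?lerDl ?lerDr sqr_ge0.
Qed.
End ScalarODE.

(** * Undamped oscillations and the complex exponential *)

Section Oscillator.
Context {R : realType}.
Local Open Scope complex_scope.
Implicit Types (a b : R -> R).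

Definition expi (t : R) : R[i] := cos t +i* sin t.

Lemma expiD (s t : R) : expi (s + t) = expi s * expi t.
Proof.
rewrite /expi cosD sinD; apply/eqP; rewrite eq_complex /=.
by rewrite eqxx /= addrC.
Qed.

Lemma expiMn (t : R) k : expi (t *+ k) = expi t ^+ k.
Proof.
elim: k => [|k IH]; first by rewrite mulr0n expr0 /expi cos0 sin0.
by rewrite mulrS expiD IH exprS.
Qed.

Lemma norm_expi (t : R) : `|expi t| = 1.
Proof. by rewrite normc_def /= cos2Dsin2 sqrtr1. Qed.

(** Equal values force [sin (s - t) = 0], and the sine has no zero strictly between 0 and 2 because
    [2 <= pi]. *)
Lemma expi_inj (s t : R) : `|s - t| < 2 -> expi s = expi t -> s = t.
Proof.
move=> st [hc hs].
have s0 : sin (s - t) = 0 by rewrite sinB hc hs mulrC subrr.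
have pos (r : R) : 0 < r -> r < 2 -> sin r != 0.
  by move=> r0 r2; rewrite gt_eqF // sin_gt0_pi // r0 (lt_le_trans r2) ?pi_ge2.
apply/eqP; rewrite -subr_eq0; move: st s0.
have [d0|d0|//] := ltgtP (s - t) 0; rewrite ltr_norml => /andP[h1 h2] /eqP.
  by rewrite -oppr_eq0 -sinN => /negPn; rewrite pos // ?oppr_gt0 // ltrNl.
by move=> /negPn; rewrite pos.
Qed.

(** Real form of [f' = i theta f] with [f = a + i b]; continuity on the closed ray ties the solution
    to its value at time 0. *)
Lemma oscillator_sol a b (theta : R) :
  {within `[0, +oo[, continuous a} -> {within `[0, +oo[, continuous b} ->
  (forall t : R, 0 < t -> is_derive t (1 : R) a (- (theta * b t))) ->
  (forall t : R, 0 < t -> is_derive t (1 : R) b (theta * a t)) ->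
  forall t, 0 <= t -> a t +i* b t = expi (theta * t) * (a 0 +i* b 0).
Proof.
move=> ca cb da db t t0.
pose c (s : R) := cos (theta * s); pose d (s : R) := sin (theta * s).
have dl (s : R) : is_derive s (1 : R) (fun s => theta * s) theta.
  by apply: is_derive_eq; rewrite scaler1.
have dc (s : R) : is_derive s (1 : R) c (- theta * d s).
  by apply: is_derive_eq; rewrite /d mulrC mulrN mulNr.
have dd (s : R) : is_derive s (1 : R) d (theta * c s).
  by apply: is_derive_eq; rewrite /c mulrC.
have cc : {within `[0, +oo[, continuous c}.
  by apply: derivable_within_continuous => s _; case: (dc s).
have cd : {within `[0, +oo[, continuous d}.
  by apply: derivable_within_continuous => s _; case: (dd s).
(* In the frame rotating at speed theta the solution is constant. *)
have h1 := @derive0_constant R (a * c + b * d).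
have h2 := @derive0_constant R (b * c - a * d).
have {}h1 : a t * c t + b t * d t = a 0.
  rewrite [LHS](h1 _ _ t t0).
  - rewrite [LHS](_ : _ = a 0 * c 0 + b 0 * d 0) //.
    by rewrite /c /d mulr0 cos0 sin0 mulr0 addr0 mulr1.
  - by move=> s; apply: continuousD; apply: continuousM;
      [exact: ca|exact: cc|exact: cb|exact: cd].
  - move=> s s0; have ha := da s s0; have hb := db s s0.
    refine (eq_ind _ (is_derive s (1 : R) _) (is_deriveD (is_deriveM ha (dc s))
      (is_deriveM hb (dd s))) _ _).
    by rewrite /GRing.scale /=; ring.
have {}h2 : b t * c t - a t * d t = b 0.
  rewrite [LHS](h2 _ _ t t0).
  - rewrite [LHS](_ : _ = b 0 * c 0 - a 0 * d 0) //.
    by rewrite /c /d mulr0 cos0 sin0 mulr0 subr0 mulr1.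
  - by move=> s; apply: continuousB; apply: continuousM;
      [exact: cb|exact: cc|exact: ca|exact: cd].
  - move=> s s0; have ha := da s s0; have hb := db s s0.
    refine (eq_ind _ (is_derive s (1 : R) _) (is_deriveB (is_deriveM hb (dc s))
      (is_deriveM ha (dd s))) _ _).
    by rewrite /GRing.scale /=; ring.
have cd1 : c t ^+ 2 + d t ^+ 2 = 1 by rewrite cos2Dsin2.
rewrite -h1 -h2 /expi -/(c t) -/(d t).
apply/eqP; rewrite eq_complex /=; apply/andP; split; apply/eqP.
  rewrite -[LHS]mulr1 -cd1; ring.
by rewrite -[LHS]mulr1 -cd1; ring.
Qed.
End Oscillator.

(** * Complex modes and decay of Hurwitz systems *)

Section ComplexPairing.
Context {R : realType}.
Local Open Scope complex_scope.

(** Bilinear, without conjugation, so that a left eigenvector turns the linear equation into a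
    scalar one with the same eigenvalue. *)
Definition cpair {n : nat} (v : 'rV[R[i]]_n) (y : 'cV[R]_n) : R[i] :=
  (v *m map_mx (real_complex R) y) 0 0.

(** Reduces a complex mode to two real row pairings, to which the real calculus above applies. *)
Lemma Re_cpair n (v : 'rV[R[i]]_n) (y : 'cV[R]_n) :
  complex.Re (cpair v y) = (map_mx (@complex.Re R) v *m y) 0 0.
Proof.
rewrite /cpair !mxE (big_morph (@complex.Re R) (id1 := 0) (op1 := +%R)) //.
  by apply: eq_bigr => j _; rewrite !mxE; case: (v 0 j) => a b /=; ring.
by case=> ? ? [].
Qed.

Lemma Im_cpair n (v : 'rV[R[i]]_n) (y : 'cV[R]_n) :
  complex.Im (cpair v y) = (map_mx (@complex.Im R) v *m y) 0 0.
Proof.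
rewrite /cpair !mxE (big_morph (@complex.Im R) (id1 := 0) (op1 := +%R)) //.
  by apply: eq_bigr => j _; rewrite !mxE; case: (v 0 j) => a b /=; ring.
by case=> ? ? [].
Qed.

Lemma cpair_real n (u : 'rV[R]_n) (y : 'cV[R]_n) :
  cpair (map_mx (real_complex R) u) y = ((u *m y) 0 0)%:C.
Proof. by rewrite /cpair -map_mxM mxE. Qed.

Lemma cpair_mulmx n m (v : 'rV[R[i]]_m) (A : 'M[R]_(m, n)) (y : 'cV[R]_n) :
  cpair v (A *m y) = cpair (v *m map_mx (real_complex R) A) y.
Proof. by rewrite /cpair map_mxM mulmxA. Qed.

Lemma cpairDl n (v w : 'rV[R[i]]_n) (y : 'cV[R]_n) :
  cpair (v + w) y = cpair v y + cpair w y.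
Proof. by rewrite /cpair mulmxDl mxE. Qed.

Lemma cpairZl n c (v : 'rV[R[i]]_n) (y : 'cV[R]_n) :
  cpair (c *: v) y = c * cpair v y.
Proof. by rewrite /cpair -scalemxAl mxE. Qed.

(* With w = v (A - z), the pairing of v solves f' = z f + g, where g is the
   pairing of w; peeling off one root at a time makes the Jordan form of A
   unnecessary. *)
Lemma linear_ode_vanish_of_annihilated n (A : 'M[R]_n) (x : R -> 'cV[R]_n)
    (rs : seq R[i]) (v : 'rV[R[i]]_n) :
  (forall t : R, 0 < t -> is_derive t (1 : R) x (A *m x t)) ->
  (forall z, z \in rs -> complex.Re z < 0) ->
  foldl (fun w z => w *m (complexify A - z%:M)) v rs = 0 ->
  complex.Re (cpair v (x t)) @[t --> +oo] --> (0 : R) /\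
  complex.Im (cpair v (x t)) @[t --> +oo] --> (0 : R).
Proof.
move=> dx; elim: rs v => [v _ /= ->|z rs IH v hrs hv].
  have E t : cpair 0 (x t) = 0 by rewrite /cpair mul0mx mxE.
  by split; under eq_fun do rewrite E; exact: cvg_cst.
have [|hg1 hg2] := IH _ _ hv.
  by move=> y yrs; apply: hrs; rewrite inE yrs orbT.
have hAv t : cpair v (A *m x t) =
    z * cpair v (x t) + cpair (v *m (complexify A - z%:M)) (x t).
  rewrite cpair_mulmx -/(complexify A) mulmxBr mul_mx_scalar -cpairZl -cpairDl.
  by rewrite addrC subrK.
apply: (@damped_oscillator_vanish R _ _ _ _ (complex.Re z) (complex.Im z)
  _ _ _ hg1 hg2).
- by apply: hrs; rewrite inE eqxx.
- move=> t t0; have := is_derive_row_pairing (map_mx (@complex.Re R) v) (dx t t0).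
  rewrite -Re_cpair (_ : (fun s => _) = fun s => complex.Re (cpair v (x s))); last first.
    by apply/funext => s; rewrite Re_cpair.
  rewrite hAv; case: z {hrs hv hg1 hg2 IH hAv} => z1 z2 /=.
  by case: (cpair v (x t)) => ? ?; case: (cpair _ (x t)).
- move=> t t0; have := is_derive_row_pairing (map_mx (@complex.Im R) v) (dx t t0).
  rewrite -Im_cpair (_ : (fun s => _) = fun s => complex.Im (cpair v (x s))); last first.
    by apply/funext => s; rewrite Im_cpair.
  rewrite hAv; case: z {hrs hv hg1 hg2 IH hAv} => z1 z2 /=.
  case: (cpair v (x t)) => ? ? /=; case: (cpair _ (x t)) => ? ? /=.
  by rewrite [X in X + _]addrC.
Qed.

(** [R[i]] is algebraically closed; [rs] repeats each eigenvalue by its algebraic multiplicity. *)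
Lemma char_poly_split n (A : 'M[R[i]]_n) :
  exists2 rs : seq R[i], char_poly A = \prod_(z <- rs) ('X - z%:P) &
    forall z, (z \in rs) = eigenvalue A z.
Proof.
have [rs hrs] := closed_field_poly_normal (char_poly A).
rewrite (monicP (char_poly_monic A)) scale1r in hrs.
exists rs => // z; rewrite eigenvalue_root_char hrs root_prod_XsubC //.
Qed.

(** Evaluation of polynomials at [A] is a ring morphism, so the successive factors multiply up to
    the characteristic polynomial at [A]. *)
Lemma Cayley_Hamilton_foldl n (A : 'M[R[i]]_n) (rs : seq R[i]) (v : 'rV[R[i]]_n) :
  char_poly A = \prod_(z <- rs) ('X - z%:P) ->
  foldl (fun w z => w *m (A - z%:M)) v rs = 0.
Proof.
case: n A v => [|n] A v hrs; first by rewrite [LHS]thinmx0.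
have -> : forall s : seq R[i], foldl (fun w z => w *m (A - z%:M)) v s =
    v *m horner_mx A (\prod_(z <- s) ('X - z%:P)).
  move=> s; elim: s v {hrs} => [|z s IH] v /=.
    by rewrite big_nil rmorph1 mulmx1.
  rewrite IH big_cons rmorphM rmorphB /= horner_mx_X horner_mx_C.
  by rewrite -mulmxE mulmxA.
by rewrite -hrs Cayley_Hamilton mulmx0.
Qed.

Lemma hurwitz_vanish n (A : 'M[R]_n) (x : R -> 'cV[R]_n) (u : 'rV[R]_n) :
  spectrum A `<=` open_left_half_plane R ->
  (forall t : R, 0 < t -> is_derive t (1 : R) x (A *m x t)) ->
  (u *m x t) 0 0 @[t --> +oo] --> (0 : R).
Proof.
move=> hA dx; have [rs hrs rsA] := char_poly_split (complexify A).
have [||+ _] := @linear_ode_vanish_of_annihilated n A x rs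
    (map_mx (real_complex R) u) dx.
- by move=> z; rewrite rsA; exact: hA.
- exact: Cayley_Hamilton_foldl.
- by under eq_fun do rewrite cpair_real.
Qed.
End ComplexPairing.

(** * Persistent excitation of the generator state *)

Section PersistentExcitation.
Context {R : realType}.
Local Open Scope complex_scope.

(** The root list of the characteristic polynomial has size [n], and multiplicity one makes it
    duplicate-free. *)
Lemma simple_eigenvalues_enum n (S : 'M[R]_n) : simple_eigenvalues S ->
  exists2 lam : 'I_n -> R[i], injective lam &
    forall j, eigenvalue (complexify S) (lam j).
Proof.
move=> hS; have [rs hrs rsS] := char_poly_split (complexify S).
have szrs : size rs = n.
  by apply: succn_inj; rewrite -(size_prod_XsubC rs id) -hrs size_char_poly.
have urs : uniq rs.
  apply: count_mem_uniq => z; have [zrs|/count_memPn//] := boolP (z \in rs).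
  have z_eig : spectrum S z by rewrite /spectrum /= -rsS.
  (* The power of ['X - z%:P] given by the count of [z] in [rs] divides the characteristic
     polynomial, so this count is at most the multiplicity. *)
  apply/eqP; rewrite eqn_leq -has_count has_pred1 zrs andbT.
  rewrite -[X in (_ <= X)%N](hS z z_eig) mup_geq; last first.
    by rewrite monic_neq0 // char_poly_monic.
  rewrite hrs (bigID (pred1 z)) /= (eq_bigr (fun=> 'X - z%:P)); last first.
    by move=> y /eqP ->.
  by rewrite big_const_seq iter_mulr_1 dvdp_mulr.
exists (fun j => nth 0 rs j) => [i j /eqP|j].
  by rewrite nth_uniq ?szrs // => /eqP /val_inj.
by rewrite -rsS mem_nth // szrs.
Qed.

Lemma Vandermonde_unit n (a : 'I_n -> R[i]) : injective a ->
  Vandermonde n (\row_j a j) \in unitmx.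
Proof.
move=> ainj; rewrite unitmxE det_Vandermonde unitfE.
apply/prodf_neq0 => i _; apply/prodf_neq0 => j ij.
by rewrite !mxE subr_eq0; apply: contraTneq ij => /ainj ->; rewrite ltnn.
Qed.

Lemma eigenvector_sol n (S : 'M[R]_n) (w : R -> 'cV[R]_n) w0 (e : 'rV[R[i]]_n) z :
  solves_ode w (fun t => S *m w t) w0 ->
  e *m complexify S = z *: e -> complex.Re z = 0 ->
  forall t, 0 <= t -> cpair e (w t) = expi (complex.Im z * t) * cpair e w0.
Proof.
move=> [<- cw dw] eS z0 t t0.
have hz s : cpair e (S *m w s) = z * cpair e (w s).
  by rewrite cpair_mulmx -/(complexify S) eS cpairZl.
have ReE : (fun s => complex.Re (cpair e (w s))) =
    (fun s => (map_mx (@complex.Re R) e *m w s) 0 0).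
  by apply/funext => s; rewrite Re_cpair.
have ImE : (fun s => complex.Im (cpair e (w s))) =
    (fun s => (map_mx (@complex.Im R) e *m w s) 0 0).
  by apply/funext => s; rewrite Im_cpair.
have := @oscillator_sol R (fun s => complex.Re (cpair e (w s)))
  (fun s => complex.Im (cpair e (w s))) (complex.Im z) _ _ _ _ t t0.
rewrite /=; case: (cpair e (w t)) => ? ? /=; case: (cpair e (w 0)) => ? ? /=.
apply.
- by rewrite ReE; exact: within_continuous_row_pairing.
- by rewrite ImE; exact: within_continuous_row_pairing.
- move=> s s0; have := is_derive_row_pairing (map_mx (@complex.Re R) e) (dw s s0).
  rewrite -ReE -Re_cpair hz; case: z {eS hz} z0 => z1 z2 /= ->.
  by case: (cpair e (w s)) => ? ? /=; rewrite mul0r add0r.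
- move=> s s0; have := is_derive_row_pairing (map_mx (@complex.Im R) e) (dw s s0).
  rewrite -ImE -Im_cpair hz; case: z {eS hz} z0 => z1 z2 /= ->.
  by case: (cpair e (w s)) => ? ? /=; rewrite mul0r add0r.
Qed.

(** In left eigenvector coordinates this makes the Krylov matrix a scaled Vandermonde matrix of the
    eigenvalues. *)
Lemma eigenvector_expmx n (S : 'M[R]_n) (e : 'rV[R[i]]_n) z (w0 : 'cV[R]_n) k :
  e *m complexify S = z *: e -> cpair e (S ^+ k *m w0) = z ^+ k * cpair e w0.
Proof.
move=> eS; elim: k => [|k IH]; first by rewrite expr0 mul1mx expr0 mul1r.
have -> : S ^+ k.+1 *m w0 = S *m (S ^+ k *m w0).
  by case: n S e w0 eS {IH} => [|n] S e w0 eS;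
    rewrite ?[LHS]flatmx0 ?[RHS]flatmx0 // exprS mulmxA mulmxE.
by rewrite cpair_mulmx -/(complexify S) eS cpairZl IH exprS mulrA.
Qed.

Lemma normc_real (a : R) : `|a%:C| = `|a|%:C.
Proof. by rewrite normc_def /= expr0n addr0 sqrtr_sqr. Qed.

(** [K] is independent of [t] because a time shift multiplies each mode by a number of modulus
    one. *)
Lemma persistently_exciting n (S : 'M[R]_n) (w : R -> 'cV[R]_n) (w0 : 'cV[R]_n) :
  simple_eigenvalues S -> spectrum S `<=` imaginary_axis R ->
  excitable S w0 -> solves_ode w (fun t => S *m w t) w0 ->
  exists2 h : R, 0 < h & exists2 K : R, 0 <= K &
    forall (t : R) (v : 'rV[R]_n) (b : R), 0 <= t ->
    (forall i : 'I_n, `|(v *m w (t + h *+ i)) 0 0| <= b) ->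
    forall j, `|v 0 j| <= K * b.
Proof.
move=> hsimple him hexc hw.
have [lam lam_inj lam_eig] := simple_eigenvalues_enum hsimple.
have Re_lam j : complex.Re (lam j) = 0 by exact/him/lam_eig.
have /choice[e eP] j : exists v : 'rV[R[i]]_n,
    v *m complexify S = lam j *: v /\ v != 0.
  by have /eigenvalueP[v ? ?] := lam_eig j; exists v.
pose theta j := complex.Im (lam j).
pose c j := cpair (e j) w0.
have z_sol j t : 0 <= t -> cpair (e j) (w t) = expi (theta j * t) * c j.
  by move=> t0; apply: eigenvector_sol hw _ _ _ t0; rewrite ?(eP j).1.
pose V : 'M[R[i]]_n := \matrix_j e j.
pose Kr := map_mx (real_complex R) (krylov S w0).
have Kr_unit : Kr \in unitmx.
  by rewrite map_unitmx -row_full_unit; exact/eqP.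
have eKr j i : (e j *m Kr) 0 i = lam j ^+ i * c j.
  rewrite -(eigenvector_expmx _ _ (eP j).1) /cpair !mxE.
  by apply: eq_bigr => k _; rewrite !mxE.
(* If [c j = 0], then [e j] annihilates every Krylov column, hence vanishes by excitability. *)
have c_neq0 j : c j != 0.
  apply: contraNneq (eP j).2 => cj0.
  rewrite -(mulmxK Kr_unit (e j)) (_ : e j *m Kr = 0) ?mul0mx //.
  by apply/rowP => i; rewrite eKr cj0 mulr0 mxE.
have V_unit : V \in unitmx.
  (* The Krylov matrix also yields the independence of the eigenvectors. *)
  have VKr : V *m Kr = diag_mx (\row_j c j) *m (Vandermonde n (\row_j lam j))^T.
    apply/row_matrixP => j; rewrite row_mul rowK; apply/rowP => i.
    by rewrite eKr mul_diag_mx !mxE mulrC.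
  have : V *m Kr \in unitmx.
    rewrite VKr unitmx_mul unitmx_tr Vandermonde_unit // andbT.
    rewrite unitmxE det_diag unitfE; apply/prodf_neq0 => j _.
    by rewrite mxE.
  by rewrite unitmx_mul => /andP[].
(* With this step all phase differences [(theta i - theta j) * h] are below 2 in absolute value, as
   [expi_inj] requires. *)
pose h := (1 + \sum_j `|theta j|)^-1.
have sum_ge0 : 0 <= \sum_j `|theta j| by apply: sumr_ge0.
have h_gt0 : 0 < h by rewrite invr_gt0 ltr_wpDr.
have theta_inj : injective theta.
  move=> i j ij; apply: lam_inj; move: ij (Re_lam i) (Re_lam j); rewrite /theta.
  by case: (lam i) => ? ?; case: (lam j) => ? ? /= -> -> ->.
have theta_le j : `|theta j| <= \sum_j `|theta j|.
  by rewrite (bigD1 j) //= lerDl sumr_ge0.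
pose rho j := expi (theta j * h).
have rho_inj : injective rho.
  move=> i j /expi_inj thij; apply: theta_inj; apply: (mulIf (lt0r_neq0 h_gt0)).
  apply: thij; rewrite -mulrBl normrM (gtr0_norm h_gt0) ltr_pdivrMr ?ltr_wpDr //.
  apply: le_lt_trans (ler_normB _ _) _.
  by have := theta_le i; have := theta_le j; lra.
pose F := Vandermonde n (\row_j rho j).
have F_unit : F^T \in unitmx by rewrite unitmx_tr Vandermonde_unit.
pose G := invmx F^T.
(* Gain of the chain from samples to mode values ([G]), to coordinates in the eigenvector basis
   (division by [c j]), to the entry [l] ([V]). Complex norms lie in [R[i]], hence the real parts
   taken below. *)
pose kap l : R[i] := \sum_j (\sum_i `|G i j|) / `|c j| * `|V j l|.
have kap_ge0 l : 0 <= kap l.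
  apply: sumr_ge0 => j _; rewrite mulr_ge0 // divr_ge0 //; exact: sumr_ge0.
have kapE l : kap l = (complex.Re (kap l))%:C by rewrite RRe_real // ger0_real.
have Rkap_ge0 l : 0 <= complex.Re (kap l) by rewrite -ler0c -kapE.
exists h => //; exists (\sum_l complex.Re (kap l)); first exact: sumr_ge0.
move=> t v b t0 vb l.
have b0 : 0 <= b by exact: le_trans (normr_ge0 _) (vb l).
apply: le_trans (_ : complex.Re (kap l) * b <= _); last first.
  by apply: ler_wpM2r => //; rewrite (bigD1 l) //= lerDl sumr_ge0.
rewrite -lecR -normc_real rmorphM /= -kapE.
pose vC := map_mx (real_complex R) v; pose u := vC *m invmx V.
pose g : 'rV[R[i]]_n := \row_j (u 0 j * (expi (theta j * t) * c j)).
pose q : 'rV[R[i]]_n := \row_i ((v *m w (t + h *+ i)) 0 0)%:C.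
(* Sample [i] advances mode [j] by [rho j ^+ i], the Vandermonde entry; the dependence on [t] stays
   inside [g]. *)
have qE : q = g *m F^T.
  apply/rowP => i; have ti0 : 0 <= t + h *+ i.
    by rewrite addr_ge0 // mulrn_wge0 // ltW.
  rewrite [LHS]mxE [RHS]mxE -cpair_real -/vC -(mulmxKV V_unit vC) -/u.
  rewrite mulmx_sum_row /cpair mulmx_suml summxE; apply: eq_bigr => j _.
  rewrite -scalemxAl mxE rowK -/(cpair _ _) z_sol //.
  rewrite !mxE -mulrA; congr (_ * _); rewrite mulrDr expiD mulrnAr expiMn.
  by rewrite mulrAC.
have gE : g = q *m G by rewrite qE mulmxK.
have g_le j : `|g 0 j| <= b%:C * \sum_i `|G i j|.
  rewrite gE mxE mulr_sumr; apply: le_trans (ler_norm_sum _ _ _) _.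
  apply: ler_sum => i _; rewrite normrM ler_wpM2r // mxE normc_real lecR.
  exact: vb.
have u_le j : `|u 0 j| <= b%:C * ((\sum_i `|G i j|) / `|c j|).
  rewrite mulrA ler_pdivlMr ?normr_gt0 //; apply: le_trans (g_le j).
  by rewrite [g 0 j]mxE !normrM norm_expi mul1r.
have -> : (v 0 l)%:C = \sum_j u 0 j * V j l.
  have -> : (v 0 l)%:C = vC 0 l by rewrite mxE.
  by rewrite -(mulmxKV V_unit vC) -/u mxE.
apply: le_trans (ler_norm_sum _ _ _) _; rewrite [leRHS]mulrC /kap mulr_sumr.
by apply: ler_sum => j _; rewrite normrM mulrA ler_wpM2r.
Qed.
End PersistentExcitation.

(** * Persistent excitation under a vanishing perturbation *)

Section Perturbation.
Context {R : realType}.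

(** Pairing with the standard basis rows gives the coordinates; there are finitely many, so a common
    threshold exists. *)
Lemma cV_vanish_bound n (eps : R -> 'cV[R]_n) (eta : R) :
  (forall u : 'rV[R]_n, (u *m eps t) 0 0 @[t --> +oo] --> (0 : R)) -> 0 < eta ->
  exists2 T : R, 0 <= T & forall t, T <= t -> forall j, `|eps t j 0| <= eta.
Proof.
move=> heps eta0.
have : \forall t \near +oo, forall j, `|eps t j 0| <= eta.
  apply: filter_forall => j.
  have /cvgrPdist_le/(_ _ eta0) := heps (delta_mx 0 j).
  by apply: filterS => t; rewrite -rowE mxE sub0r normrN.
move=> [T0 [_ hT0]]; exists (Num.max 0 (T0 + 1)); first by rewrite le_max lexx.
move=> t; rewrite ge_max => /andP[_ T0t]; apply: hT0.
by apply: lt_le_trans T0t; rewrite ltrDl.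
Qed.

(** The hypothesis on [w], applied to [v *m P], gives [N <= K0 * kap * (b + N * eta)] for the sum
    [N] of the absolute entries of [v]; for small [eta] the term in [N] is absorbed on the left. *)
Lemma persistently_exciting_perturb n (P : 'M[R]_n) (w y eps : R -> 'cV[R]_n)
    (h K0 : R) : P \in unitmx -> 0 < h -> 0 <= K0 ->
  (forall (t : R) (v : 'rV[R]_n) (b : R), 0 <= t ->
    (forall i : 'I_n, `|(v *m w (t + h *+ i)) 0 0| <= b) ->
    forall j, `|v 0 j| <= K0 * b) ->
  (forall t, 0 <= t -> y t = P *m w t + eps t) ->
  (forall u : 'rV[R]_n, (u *m eps t) 0 0 @[t --> +oo] --> (0 : R)) ->
  exists2 T : R, 0 <= T & exists2 K : R, 0 <= K &
    forall (t : R) (v : 'rV[R]_n) (b : R), T <= t ->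
    (forall i : 'I_n, `|(v *m y (t + h *+ i)) 0 0| <= b) ->
    forall j, `|v 0 j| <= K * b.
Proof.
move=> P_unit h0 K00 hK0 hy heps.
pose kap := \sum_l \sum_j `|invmx P j l|.
have kap0 : 0 <= kap by apply: sumr_ge0 => l _; exact: sumr_ge0.
(* Chosen so that [K0 * kap * eta <= 1 / 2]; the added 1 keeps the denominator positive. *)
pose eta := (2 * (K0 * kap + 1))^-1.
have K0kap : 0 <= K0 * kap by rewrite mulr_ge0.
have eta0 : 0 < eta by rewrite invr_gt0; lra.
have [T T0 hT] := cV_vanish_bound heps eta0.
exists T => //; exists (2 * (K0 * kap)); first by rewrite mulr_ge0.
move=> t v b Tt vb.
have t0 : 0 <= t := le_trans T0 Tt.
pose N := \sum_j `|v 0 j|.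
have N0 : 0 <= N by exact: sumr_ge0.
have vP_le j : `|(v *m P) 0 j| <= K0 * (b + N * eta).
  apply: (hK0 t) => // i; set s := t + h *+ i.
  have ts : t <= s by rewrite lerDl mulrn_wge0 // ltW.
  have -> : (v *m P *m w s) 0 0 = (v *m y s) 0 0 - (v *m eps s) 0 0.
    by rewrite hy ?(le_trans t0) // mulmxDr mulmxA [X in X - _]mxE addrK.
  apply: le_trans (ler_normB _ _) _; apply: lerD; first exact: vb.
  rewrite mxE mulr_suml; apply: le_trans (ler_norm_sum _ _ _) _.
  apply: ler_sum => k _; rewrite normrM ler_wpM2l //.
  by apply: hT; exact: le_trans ts.
have N_le : N <= K0 * (b + N * eta) * kap.
  rewrite mulr_sumr; apply: ler_sum => l _.
  have -> : v 0 l = (v *m P *m invmx P) 0 l by rewrite mulmxK.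
  rewrite mxE mulr_sumr.
  apply: le_trans (ler_norm_sum _ _ _) _.
  by apply: ler_sum => j _; rewrite normrM ler_wpM2r.
have eta_half : K0 * kap * eta <= 2^-1.
  rewrite /eta invfM mulrCA ger_pMr ?invr_gt0 //.
  rewrite ler_pdivrMr; lra.
move=> j; apply: (@le_trans _ _ N).
  by rewrite /N (bigD1 j) //= lerDl sumr_ge0.
have : N * (K0 * kap * eta) <= N * 2^-1 by exact: ler_wpM2l.
move: N_le; rewrite (_ : K0 * (b + N * eta) * kap =
  K0 * kap * b + N * (K0 * kap * eta)); last by ring.
lra.
Qed.
End Perturbation.

(** * Least squares and snapshot matrices *)

Section LeastSquares.
Context {R : realType}.

Lemma sqnorm_cV m (z : 'cV[R]_m) : (z^T *m z) 0 0 = \sum_i z i 0 ^+ 2.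
Proof. by rewrite mxE; apply: eq_bigr => i _; rewrite mxE. Qed.

Lemma sqnorm_cV_eq0 m (z : 'cV[R]_m) : (z^T *m z) 0 0 = 0 -> z = 0.
Proof.
rewrite sqnorm_cV => /eqP; rewrite psumr_eq0 => [/allP hz|i _]; last exact: sqr_ge0.
apply/colP => i; rewrite mxE; apply/eqP; rewrite -sqrf_eq0.
by apply: hz; rewrite mem_index_enum.
Qed.

(** If [v] is in the left kernel of the Gram matrix, the squared norm of [M *m v^T] is zero, and
    full column rank gives [v = 0]. *)
Lemma gram_unitmx m n (M : 'M[R]_(m, n)) : full_column_rank M -> M^T *m M \in unitmx.
Proof.
move=> rM; rewrite -row_free_unit -kermx_eq0; apply/rowV0P => v /sub_kermxP.
rewrite mulmxA => vMM.
have : M *m v^T = 0.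
  apply: sqnorm_cV_eq0; rewrite trmx_mul trmxK mulmxA vMM mul0mx mxE //.
move/(congr1 trmx); rewrite trmx_mul trmxK trmx0 => vM.
have fM : row_free M^T by rewrite /row_free mxrank_tr rM.
by apply: (row_free_inj fM); rewrite vM mul0mx.
Qed.

(* M applied to the least-squares solution is the orthogonal projection of r onto
   the column space of M. *)
Lemma least_squares_residual m n (M : 'M[R]_(m, n)) (r : 'cV[R]_m) (i : 'I_m) :
  full_column_rank M ->
  (M *m (invmx (M^T *m M) *m M^T *m r)) i 0 ^+ 2 <= \sum_j r j 0 ^+ 2.
Proof.
move=> rM; set th := invmx _ *m _ *m _.
(* The normal equations make [M *m th] orthogonal to [r - M *m th]; expanding the squared norm of
   that difference then gives the bound. *)
have normal : M^T *m (M *m th) = M^T *m r.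
  by rewrite mulmxA /th -[invmx _ *m _ *m r]mulmxA mulKVmx // gram_unitmx.
apply: (@le_trans _ _ (\sum_j (M *m th) j 0 ^+ 2)).
  by rewrite (bigD1 i) //= lerDl sumr_ge0 // => j _; exact: sqr_ge0.
rewrite -!sqnorm_cV.
have : 0 <= ((r - M *m th)^T *m (r - M *m th)) 0 0.
  by rewrite sqnorm_cV sumr_ge0 // => j _; exact: sqr_ge0.
have cross : (M *m th)^T *m r = (M *m th)^T *m (M *m th).
  by rewrite trmx_mul -!mulmxA normal.
have cross' : r^T *m (M *m th) = (M *m th)^T *m (M *m th).
  by apply: trmx_inj; move: (M *m th) cross => z cross; rewrite !trmx_mul !trmxK.
rewrite [(_ - _)^T]linearB /= mulmxBl !mulmxBr cross cross' subrr subr0 mxE.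
by rewrite [X in _ + X]mxE subr_ge0.
Qed.

Lemma sum_mxtens m n (F : 'I_m * 'I_n -> R) :
  \sum_(k < m * n) F (mxtens_unindex k) = \sum_i \sum_j F (i, j).
Proof.
rewrite pair_bigA (reindex (@mxtens_index m n)) /=; last first.
  by exists (@mxtens_unindex m n) => ? _; rewrite ?mxtens_indexK ?mxtens_unindexK.
by apply: eq_bigr => -[i j] _; rewrite mxtens_indexK.
Qed.

(** Blockwise Kronecker identity [(y^T *t I) vec D = D y], which column stacking makes valid. *)
Lemma snapshot_M_vec nu p (y : R -> 'cV[R]_nu) t k (D : 'M[R]_nu) r :
  (snapshot_M p y t k *m vec D) r 0 =
  (D *m y (window t k (mxtens_unindex r).1)) (mxtens_unindex r).2 0.
Proof.
rewrite !mxE; set s := window _ _ _; set a := (_).2.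
pose F (c : 'I_nu * 'I_nu) := y s c.1 0 * (a == c.2)%:R * D c.2 c.1.
rewrite (eq_bigr (fun c => F (mxtens_unindex c))); last first.
  by move=> c _; rewrite !mxE !mxtens_indexK /F /=.
rewrite sum_mxtens; apply: eq_bigr => j _.
rewrite (bigD1 a) //= big1 ?addr0 => [|i ia]; last first.
  by rewrite /F /= eq_sym (negbTE ia) mulr0 mul0r.
by rewrite /F /= eqxx mulr1 mulrC.
Qed.

(** The least-squares operator is a left inverse of [M], so subtracting [X] replaces the data by the
    residual at [X]. *)
Lemma estimate_error nu p (y w : R -> 'cV[R]_nu) t k (X : 'M[R]_nu) :
  full_column_rank (snapshot_M p y t k) ->
  let M := snapshot_M p y t k in
  vec (estimate p y w t k - X) =
  invmx (M^T *m M) *m M^T *m (snapshot_N p w t k - M *m vec X).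
Proof.
move=> rM M; rewrite mulmxBr -[invmx _ *m _ *m (M *m _)]mulmxA [M^T *m (M *m _)]mulmxA.
rewrite mulKmx ?gram_unitmx //.
have vecB (Y Z : 'M[R]_nu) : vec (Y - Z) = vec Y - vec Z.
  by apply/colP => i; rewrite !mxE.
by rewrite vecB /estimate unvecK.
Qed.

Lemma estimate_error_sample nu p (y w : R -> 'cV[R]_nu) t k (X : 'M[R]_nu)
    (delta : R) : 0 <= delta ->
  full_column_rank (snapshot_M p y t k) ->
  (forall (i : 'I_p) a, `|(w (window t k i) - X *m y (window t k i)) a 0| <= delta) ->
  forall (i : 'I_p) a,
    `|((estimate p y w t k - X) *m y (window t k i)) a 0| <= (p * nu).+1%:R * delta.
Proof.
move=> d0 rM hd i a.
have := least_squares_residual (snapshot_N p w t k - snapshot_M p y t k *m vec X)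
  (mxtens_index (i, a)) rM.
rewrite -estimate_error // snapshot_M_vec mxtens_indexK /= => /le_trans h.
rewrite -(@ler_pXn2r _ 2) ?nnegrE ?mulr_ge0 // real_normK ?num_real //.
apply: h; apply: (@le_trans _ _ (\sum_(j < p * nu) delta ^+ 2)).
  apply: ler_sum => j _; rewrite -real_normK ?num_real // ler_pXn2r ?nnegrE //.
  rewrite (_ : _ j 0 = (w (window t k (mxtens_unindex j).1) -
    X *m y (window t k (mxtens_unindex j).1)) (mxtens_unindex j).2 0) //.
  rewrite [LHS]mxE [RHS]mxE; congr (_ + _); first by rewrite mxE.
  by rewrite [LHS]mxE snapshot_M_vec [RHS]mxE.
(* The factor [p * nu + 1] stands in for the square root of [p * nu], by [m <= (m + 1)^2]. *)
rewrite sumr_const card_ord -[leLHS]mulr_natl exprMn.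
apply: ler_wpM2r; first exact: sqr_ge0.
by rewrite -natrX ler_nat expnS expn1 -[X in (X <= _)%N]muln1 leq_mul.
Qed.

(** A kernel vector is [vec D] with [D y = 0] at every sample, so the hypothesis applies to each row
    of [D]. *)
Lemma full_column_rank_snapshot nu p (y : R -> 'cV[R]_nu) t k :
  (forall v : 'rV[R]_nu, (forall i : 'I_p, (v *m y (window t k i)) 0 0 = 0) -> v = 0) ->
  full_column_rank (snapshot_M p y t k).
Proof.
move=> hy; apply/eqP; rewrite -mxrank_tr -/(row_free _) -kermx_eq0.
apply/rowV0P => v /sub_kermxP vM.
have Mv : snapshot_M p y t k *m v^T = 0.
  by apply: trmx_inj; rewrite trmx_mul trmxK vM trmx0.
suff D0 : unvec v^T = 0 :> 'M[R]_nu.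
  apply: trmx_inj; rewrite -(unvecK v^T) D0 trmx0.
  by apply/colP => i; rewrite !mxE.
apply/row_matrixP => a; rewrite row0; apply: hy => i.
have := congr1 (fun z : 'cV_(p * nu) => z (mxtens_index (i, a)) 0) Mv.
rewrite -{1}(unvecK v^T) snapshot_M_vec mxtens_indexK /= -row_mul => Dy.
by rewrite mxE Dy mxE.
Qed.
End LeastSquares.

(** * Convergence of the estimate under constant-step sampling *)

Unset Implicit Arguments.
Set Strict Implicit.

Theorem corollary7 (R : realType) (n nu p : nat)
  (A : 'M[R]_n) (B : 'cV[R]_n) (C : 'rV[R]_n)
  (S Q : 'M[R]_nu) (L : 'rV[R]_nu) (Rm : 'cV[R]_nu)
  (Pi : 'M[R]_(n, nu)) (Ups : 'M[R]_(nu, n))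
  (omega0 : 'cV[R]_nu)
  (omega varpi d : R -> 'cV[R]_nu) (x : R -> 'cV[R]_n)
  (hAB : controllable A B) (hAC : observable A C)
  (hPi : A *m Pi + B *m L = Pi *m S)
  (hUps : Q *m Ups = Ups *m A + Rm *m C)
  (homega : solves_ode omega (fun t => S *m omega t) omega0)
  (hx : solves_ode x (fun t => A *m x t + B *m L *m omega t) 0)
  (hvarpi : solves_ode varpi (fun t => Q *m varpi t + Rm *m C *m x t) 0)
  (hd : forall t : R, 0 <= t -> d t = varpi t + Ups *m x t)
  (hSL : observable S L) (hQR : controllable Q Rm)
  (hA : spectrum A `<=` open_left_half_plane R)
  (hSsimple : simple_eigenvalues S) (hS : spectrum S `<=` imaginary_axis R)
  (hexc : excitable S omega0)
  (hQsimple : simple_eigenvalues Q) (hQ : spectrum Q `<=` imaginary_axis R)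
  (hSA : spectrum S `&` spectrum A = set0)
  (hQA : spectrum Q `&` spectrum A = set0)
  (hSQ : spectrum S `&` spectrum Q = set0)
  (hUpsPi : Ups *m Pi \in unitmx)
  (hp : (nu <= p)%N)
  (hM : exists t : nat -> R, admissible_sampling p (fun s => d s - varpi s) t) :
  exists2 t : nat -> R, admissible_sampling p (fun s => d s - varpi s) t &
    estimate p (fun s => d s - varpi s) omega t @ \oo --> invmx (Ups *m Pi).
Proof.
set y := fun s => d s - varpi s.
pose e s := x s - Pi *m omega s.
have de (t : R) : 0 < t -> is_derive t (1 : R) e (A *m e t).
  move=> t0; have [_ _ /(_ t t0) dw] := homega; have [_ _ /(_ t t0) dx] := hx.
  have <- : A *m x t + B *m L *m omega t - Pi *m (S *m omega t) = A *m e t.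
    rewrite mulmxA -hPi mulmxDl opprD addrACA subrr addr0 mulmxBr mulmxA //.
  apply: is_deriveB; exact: is_derive_mulmx.
have eps_vanish (u : 'rV[R]_nu) : (u *m (Ups *m e t)) 0 0 @[t --> +oo] --> (0 : R).
  under eq_fun do rewrite mulmxA.
  exact: hurwitz_vanish hA de.
have yE t : 0 <= t -> y t = Ups *m Pi *m omega t + Ups *m e t.
  move=> t0; rewrite /y hd // [_ + Ups *m x t]addrC addrK -mulmxA -mulmxDr.
  by rewrite addrC subrK.
have [h h0 [K0 K00 hK0]] := persistently_exciting hSsimple hS hexc homega.
have [T T0 [K K_ge0 hK]] :=
  persistently_exciting_perturb hUpsPi h0 K00 hK0 yE eps_vanish.
pose t (k : nat) := T + h *+ k.
have T_le k : T <= t k by rewrite lerDl mulrn_wge0 // ltW.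
have t_ge A0 : exists k0, forall k, (k0 <= k)%N -> A0 <= t k.
  exists (Num.bound `|(A0 - T) / h|) => k hk.
  rewrite -lerBlDl -mulr_natl -ler_pdivrMr //.
  apply: ltW; apply: le_lt_trans (ler_norm _) _.
  by apply: lt_le_trans (archi_boundP (normr_ge0 _)) _; rewrite ler_nat.
(* Subtraction is truncated: for [k + 1 < p] the window starts at [t 0 = T], so the bounds below
   hold for every [k]. *)
have windowE k (i : 'I_p) : window t k i = t (k.+1 - p)%N + h *+ i.
  by rewrite /window /t mulrnDr addrA.
have window_bound k (v : 'rV[R]_nu) b :
    (forall i : 'I_p, `|(v *m y (window t k i)) 0 0| <= b) ->
    forall j, `|v 0 j| <= K * b.
  (* The first [nu] of the [p] samples suffice; [hp] embeds their indices. *)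
  move=> hb; apply: (hK (t (k.+1 - p)%N)) => // i.
  by rewrite -(windowE k (widen_ord hp i)).
(* The uniform bound at [b = 0]: a row annihilating all samples is zero. *)
have t_full k : full_column_rank (snapshot_M p y t k).
  apply: full_column_rank_snapshot => v hv; apply/rowP => j; rewrite mxE.
  apply/eqP; rewrite -normr_le0 -(mulr0 K); apply: (window_bound k) => i.
  by rewrite hv normr0.
exists t.
  split => //; first by rewrite /t mulr0n addr0.
    by move=> k; rewrite /t ltrD2l mulrS ltrDr.
  apply/cvgryPge => A0; have [k0 hk0] := t_ge A0.
  by exists k0.
(* Up to sign, this vector is the residual [omega - (Ups Pi)^-1 y]. *)
have P_vanish (u : 'rV[R]_nu) :
    (u *m (invmx (Ups *m Pi) *m (Ups *m e s))) 0 0 @[s --> +oo] --> (0 : R).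
  under eq_fun do rewrite mulmxA.
  exact: eps_vanish.
apply/cvgrPdist_le => r r0.
(* Gain from residuals to entries of the error, plus 1 so that division by [c] is legitimate. *)
pose c := K * (p * nu).+1%:R + 1.
have c0 : 0 < c by rewrite ltr_wpDl ?mulr_ge0.
have del0 : 0 < r / c by rewrite divr_gt0.
have [T1 _ hT1] := cV_vanish_bound P_vanish del0.
have [k0 hk0] := t_ge T1.
(* The shift by [p] places even the oldest sample of the window at an index at least [k0]. *)
exists (k0 + p)%N => // k /= hk.
have win_ge (i : 'I_p) : T1 <= window t k i.
  rewrite windowE; apply: le_trans (hk0 (k.+1 - p)%N _) _.
    have pk : (p <= k.+1)%N by apply: leqW; exact: leq_trans (leq_addl _ _) hk.
    by rewrite leq_subRL // addnC leqW.
  by rewrite lerDl mulrn_wge0 // ltW.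
rewrite distrC [leLHS]/Num.Def.normr/= mx_normrE (bigmax_le _ (ltW r0))//= => -[a j] _ /=.
set D := _ - _.
have -> : D a j = row a D 0 j by rewrite [RHS]mxE.
(* The projection bounds a row of [D] on the samples, and excitation turns this into a bound on its
   entries. *)
apply: (@le_trans _ _ (K * ((p * nu).+1%:R * (r / c)))).
  apply: (window_bound k) => i.
  rewrite -row_mul [(row _ _) _ _]mxE.
  apply: estimate_error_sample => //; first exact: ltW.
  move=> {}i {}a; have wi : 0 <= window t k i.
    by rewrite (le_trans T0) // windowE ler_wpDr // mulrn_wge0 // ltW.
  rewrite yE // mulmxDr mulKmx // opprD addrA subrr sub0r mxE normrN.
  exact: hT1.
rewrite [leLHS](_ : _ = r * (K * (p * nu).+1%:R / c)); last first.
  by rewrite [LHS]mulrA [LHS]mulrCA.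
by rewrite ger_pMr // ler_pdivrMr // mul1r lerDl.
Qed.
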